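(* Let $X$ be a complete topologized semilattice, let $Y$ be a sequential Hausdorff semitopological semilattice, and let $h:X\to Y$ be a continuous homomorphism. Then the image $h(X)$ is closed in $Y$.
   Context: A semilattice is a commutative semigroup all of whose elements are idempotents ($xx=x$); it carries the natural partial order $x\le y$ iff $xy=x=yx$. A homomorphism of semilattices is a semigroup homomorphism. A chain in a semilattice is a subset any two elements of which are comparable in this order; $\inf$ and $\sup$ are taken with respect to this order. A topologized semilattice is a semilattice endowed with an arbitrary topology (no continuity of the operation and no separation axiom assumed). A semitopological semilattice is a topologized semilattice $Y$ whose operation $Y\times Y\to Y$, $(x,y)\mapsto xy$, is separately continuous. A topologized semilattice $X$ is complete if each non-empty chain $C\subset X$ has an infimum and a supremum in $X$, and both $\inf C$ and $\sup C$ belong to the closure $\bar C$ of $C$ in $X$. A subset $A$ of a topological space $Y$ is sequentially closed if $A$ contains the limits of all sequences of points of $A$ that converge in $Y$. A space $Y$ is sequential if each sequentially closed subset of $Y$ is closed. *)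

(* Defs.v *)
From HB Require Import structures.
From mathcomp Require Import all_boot.
From mathcomp Require Import boolp classical_sets filter topology.

Set Implicit Arguments.
Unset Strict Implicit.
Unset Printing Implicit Defensive.

Local Open Scope classical_set_scope.
Local Open Scope group_scope.

HB.mixin Record Semigroup_isSemilattice T of Semigroup T := {
  slmulC : commutative (@mul T);
  slmulxx : idempotent_op (@mul T)
}.

#[short(type="semilatticeType")]
HB.structure Definition Semilattice :=
  { T of Semigroup_isSemilattice T & Semigroup T }.

(* No compatibility between the topology and the product is required. *)
#[short(type="topologizedSemilatticeType")]
HB.structure Definition TopologizedSemilattice :=
  { T of Topological T & Semilattice T }.

Definition semitopological (Y : topologizedSemilatticeType) : Prop :=
  (forall a : Y, continuous (fun y : Y => a * y)) /\
  (forall a : Y, continuous (fun y : Y => y * a)).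

Section NaturalOrder.
Variable X : semilatticeType.
Implicit Types (C : set X) (a b x y : X).

Definition sl_le x y : Prop := x * y = x /\ x = y * x.

Definition chain C : Prop := total_on C sl_le.

Definition is_infimum C a : Prop :=
  (forall x, C x -> sl_le a x) /\
  (forall b, (forall x, C x -> sl_le b x) -> sl_le b a).

Definition is_supremum C a : Prop :=
  (forall x, C x -> sl_le x a) /\
  (forall b, (forall x, C x -> sl_le x b) -> sl_le a b).

End NaturalOrder.

Definition complete_semilattice (X : topologizedSemilatticeType) : Prop :=
  forall C : set X, C !=set0 -> chain C ->
    (exists2 a : X, is_infimum C a & closure C a) /\
    (exists2 b : X, is_supremum C b & closure C b).

Definition sequentially_closed (T : topologicalType) (A : set T) : Prop :=
  forall (u : nat -> T) (l : T), (forall n, A (u n)) -> u @ \oo --> l -> A l.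

Definition sequential_space (T : topologicalType) : Prop :=
  forall A : set T, sequentially_closed A -> closed A.

(* Main.v *)
Require Import Defs.
From mathcomp Require Import all_boot.
From mathcomp Require Import boolp classical_sets filter topology.

(** Since Y is sequential, it suffices that the limit y of a sequence
    [h (u n)] lies in the range of h.

    Completeness gives every sequence u in X a limit inferior: the partial
    products of a tail of u form a chain, whose infimum is the infimum of that
    tail, and the infima of the tails form an increasing chain, whose supremum
    is w u.  As the cones of Y are closed, h sends the infima of the tails, and
    with them w u, below y, but [h (w u)] may be different from y.  Passing to a
    sequence v whose tails are contained in those of u can only raise w, and if
    [h (w u)] is not y, then a thin enough v has [h (w v)] different from
    [h (w u)] ([finer_liminf_neq]): choose v so that all its partial products,
    multiplied by y, stay in an open set around y that avoids a neighbourhood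
    of [h (w u)].  Separate continuity is enough for that, because only
    finitely many products have to be controlled at each step.

    Suppose that y is not in the range.  Then refinement can go on forever,
    also through countable limits, since countably many successively finer
    sequences have a common refinement ([finer_countable_bound]).  Classically
    one would build a strictly increasing family of limits inferior indexed by
    the first uncountable ordinal.  Zorn's lemma gives a substitute
    ([strictly_directed_chain]): a chain K of sequences every countable part of
    which has a strict bound in K.  Let s be the supremum in X of all w t with
    t in K; it is in the closure of those points.  The set D of all points of Y
    below some [h (w t)] is sequentially closed, as the countably many bounds
    used by a sequence have a common one, so D is closed and contains [h s].
    Thus [h s] lies below [h (w t)] for a single t in K, which a strictly finer
    member of K contradicts. *)

Local Open Scope classical_set_scope.

Set Implicit Arguments.
Unset Strict Implicit.

(** * Order and sequences in a semilattice *)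

Section SemilatticeOrder.
Variable X : semilatticeType.
Implicit Types a b c x y : X.

Lemma sl_leP {x y} : sl_le x y <-> (x * y)%g = x.
Proof. by split=> [[] //|xy]; split=> //; rewrite slmulC. Qed.

Lemma sl_le_refl x : sl_le x x.
Proof. by apply/sl_leP; rewrite slmulxx. Qed.

Lemma sl_le_trans y x z : sl_le x y -> sl_le y z -> sl_le x z.
Proof. by move=> /sl_leP xy /sl_leP yz; apply/sl_leP; rewrite -xy -mulgA yz. Qed.

Lemma sl_le_anti x y : sl_le x y -> sl_le y x -> x = y.
Proof. by move=> /sl_leP xy /sl_leP yx; rewrite -xy slmulC yx. Qed.

Lemma sl_mul_lel x y : sl_le (x * y)%g x.
Proof. by apply/sl_leP; rewrite slmulC mulgA slmulxx. Qed.

Lemma sl_mul_ler x y : sl_le (x * y)%g y.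
Proof. by rewrite slmulC; exact: sl_mul_lel. Qed.

Lemma sl_le_mul a x y : sl_le a x -> sl_le a y -> sl_le a (x * y)%g.
Proof. by move=> /sl_leP ax /sl_leP ay; apply/sl_leP; rewrite mulgA ax. Qed.

Lemma infimum_unique (C : set X) a b : is_infimum C a -> is_infimum C b -> a = b.
Proof. by move=> [la ga] [lb gb]; apply: sl_le_anti; [exact: gb|exact: ga]. Qed.

Lemma supremum_unique (C : set X) a b :
  is_supremum C a -> is_supremum C b -> a = b.
Proof. by move=> [la ga] [lb gb]; apply: sl_le_anti; [exact: ga|exact: gb]. Qed.

Lemma chain_range_nonincreasing (u : nat -> X) :
  (forall m n, (m <= n)%N -> sl_le (u n) (u m)) -> chain (range u).
Proof.
move=> ud _ _ [m _ <-] [n _ <-].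
by case/orP: (leq_total m n) => /ud; [right|left].
Qed.

Lemma chain_range_nondecreasing (u : nat -> X) :
  (forall m n, (m <= n)%N -> sl_le (u m) (u n)) -> chain (range u).
Proof.
move=> ud _ _ [m _ <-] [n _ <-].
by case/orP: (leq_total m n) => /ud; [left|right].
Qed.

Definition shift m (u : nat -> X) n := u (m + n)%N.

Fixpoint prefix_prod (u : nat -> X) n :=
  if n is n'.+1 then (prefix_prod u n' * u n)%g else u 0%N.

Lemma prefix_prod_le u n : sl_le (prefix_prod u n) (u n).
Proof. by case: n => [|n] /=; [exact: sl_le_refl|exact: sl_mul_ler]. Qed.

Lemma prefix_prod_nonincreasing u m n :
  (m <= n)%N -> sl_le (prefix_prod u n) (prefix_prod u m).
Proof.
move=> /subnKC <-; elim: (n - m)%N => [|k IH].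
  by rewrite addn0; exact: sl_le_refl.
by rewrite addnS /=; exact: sl_le_trans (sl_mul_lel _ _) IH.
Qed.

Lemma prefix_prod_ge b u n :
  (forall k, sl_le b (u k)) -> sl_le b (prefix_prod u n).
Proof. by move=> bu; elim: n => [|n IH] //=; exact: sl_le_mul. Qed.

(** Chain completeness speaks about chains only; this lemma makes it apply to
    arbitrary sequences, whose partial products do form a chain. *)
Lemma prefix_prod_infimum u a :
  is_infimum (range (prefix_prod u)) a <-> is_infimum (range u) a.
Proof.
have lb b : (forall x, range (prefix_prod u) x -> sl_le b x) <->
            (forall x, range u x -> sl_le b x).
  split=> bu _ [n _ <-].
    by apply: sl_le_trans (prefix_prod_le u n); apply: bu; exists n.
  by apply: prefix_prod_ge => k; apply: bu; exists k.
by split=> -[la ga]; (split; [exact/lb|by move=> b /lb; exact: ga]).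
Qed.

(** The limit inferior of u, as a relation: [z m] is the infimum of the
    [m]-th tail. *)
Definition is_liminf (u : nat -> X) w := exists2 z : nat -> X,
  forall m, is_infimum (range (shift m u)) (z m) & is_supremum (range z) w.

(** Comparing the filters generated by the tails, instead of asking v to be a
    subsequence of u, makes the relation blind to finite initial segments, to
    repetitions and to the order of the terms.  Diagonal sequences are then
    common refinements without any bookkeeping of indices. *)
Definition finer (v u : nat -> X) := u @ \oo `<=` v @ \oo.

Lemma finer_tailP v u :
  finer v u <-> forall m, \forall n \near \oo, (u @` [set j | (m <= j)%N]) (v n).
Proof.
split=> [vu m|vu S [m _ mS]].
  by apply: (vu (u @` [set j | (m <= j)%N])); exists m => // j mj; exists j.
have [k _ kv] := vu m; exists k => // n /kv [j mj uj].
by rewrite /preimage /= -uj; exact: mS.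
Qed.

Lemma finer_trans v u t : finer v u -> finer u t -> finer v t.
Proof. by move=> vu ut S /ut /vu. Qed.

(** Each tail of u contains a tail of v, so its infimum is below one of the
    infima that define the limit inferior of v. *)
Lemma finer_le_liminf u v a b :
  finer v u -> is_liminf u a -> is_liminf v b -> sl_le a b.
Proof.
move=> /finer_tailP vu [z zu [_ az]] [t tv [bt _]].
apply: az => _ [m _ <-]; have [k _ kv] := vu m.
apply: (@sl_le_trans (t k)); last by apply: bt; exists k.
apply: (tv k).2 => _ [n _ <-]; rewrite /shift.
have [j /= mj <-] := kv (k + n)%N (leq_addr _ _).
by apply: (zu m).1; exists (j - m)%N => //; rewrite /shift subnKC.
Qed.

(** Diagonal argument: comparability makes any n + 1 of the sequences have a
    finest one, some term of which lies in the n-th tails of all of them; take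
    such a term as the n-th term of v. *)
Lemma finer_countable_bound (u : nat -> nat -> X) :
  (forall i j, finer (u i) (u j) \/ finer (u j) (u i)) ->
  exists v, forall i, finer v (u i).
Proof.
move=> tot.
have mini n : exists i, forall k, (k <= n)%N -> finer (u i) (u k).
  elim: n => [|n [i IH]]; first by exists 0%N => k; rewrite leqn0 => /eqP ->.
  have [iS|Si] := tot i n.+1.
    by exists i => k; rewrite leq_eqVlt => /orP[/eqP->|/IH].
  exists n.+1 => k; rewrite leq_eqVlt => /orP[/eqP-> //|kn].
  exact: finer_trans Si (IH _ kn).
have diag n : exists x, forall k, (k <= n)%N ->
    (u k @` [set j | (n <= j)%N]) x.
  have [i iu] := mini n.
  have [N _ NP] : \forall p \near \oo, forall k : 'I_n.+1,
      (u k @` [set j | (n <= j)%N]) (u i p).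
    apply: filter_forall => k; have /iu /finer_tailP := ltn_ord k; exact.
  exists (u i N) => k kn; exact: (NP N (leqnn N) (Ordinal (kn : (k < n.+1)%N))).
have [v vP] := choice diag; exists v => i; apply/finer_tailP => m.
exists (maxn i m) => // n /=; rewrite geq_max => /andP[/vP [j nj <-] mn].
by exists j => //=; exact: leq_trans mn nj.
Qed.

Lemma finer_cvg {T : topologicalType} (f : X -> T) v u (y : T) :
  finer v u -> f \o u @ \oo --> y -> f \o v @ \oo --> y.
Proof. by move=> vu uy S /uy; exact: (vu (f @^-1` S)). Qed.

End SemilatticeOrder.

(** * Limits inferior in a complete semilattice *)

Lemma homo_sl_le {X Y : semilatticeType} (h : {multiplicative X -> Y}) x x' :
  sl_le x x' -> sl_le (h x) (h x').
Proof. by move=> /sl_leP xx; apply/sl_leP; rewrite -gmulfM xx. Qed.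

Lemma closure_min {T : topologicalType} {A B : set T} x :
  A `<=` B -> closed B -> closure A x -> B x.
Proof. by move=> AB Bc Ax; apply: Bc; exact: closureS Ax. Qed.

Section CompleteSemilattice.
Variable X : topologizedSemilatticeType.
Hypothesis Xc : complete_semilattice X.

Lemma supremum_closure (C : set X) b :
  C !=set0 -> chain C -> is_supremum C b -> closure C b.
Proof.
by move=> C0 Cch Cb; have [_ [b' /(supremum_unique Cb) ->]] := Xc C0 Cch.
Qed.

Lemma chain_prefix_prod (u : nat -> X) : chain (range (prefix_prod u)).
Proof. by apply: chain_range_nonincreasing; exact: prefix_prod_nonincreasing. Qed.

Lemma sequence_infimum (u : nat -> X) : exists a, is_infimum (range u) a.
Proof.
have [[a /prefix_prod_infimum ua _] _] :=
  Xc (ex_intro _ _ (imageT (prefix_prod u) 0%N)) (@chain_prefix_prod u).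
by exists a.
Qed.

Lemma sequence_infimum_closure (u : nat -> X) a :
  is_infimum (range u) a -> closure (range (prefix_prod u)) a.
Proof.
move=> /prefix_prod_infimum ua.
have [[b ub ?] _] :=
  Xc (ex_intro _ _ (imageT (prefix_prod u) 0%N)) (@chain_prefix_prod u).
by rewrite (infimum_unique ua ub).
Qed.

Lemma chain_tail_infima (u z : nat -> X) :
  (forall m, is_infimum (range (shift m u)) (z m)) -> chain (range z).
Proof.
move=> zu; apply: chain_range_nondecreasing => m n mn.
apply: (zu n).2 => _ [k _ <-]; apply: (zu m).1.
by exists (n - m + k)%N => //; rewrite /shift addnA subnKC.
Qed.

Lemma liminf_exists (u : nat -> X) : exists w, is_liminf u w.
Proof.
have [z zu] := choice (fun m => sequence_infimum (shift m u)).
have [_ [w zw _]] :=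
  Xc (ex_intro _ _ (imageT z 0%N)) (chain_tail_infima zu).
by exists w, z.
Qed.

(** Closedness passes from the infima of the tails to the limit inferior,
    because the latter is in the closure of the former. *)
Lemma liminf_closed (D : set X) (u : nat -> X) w : closed D ->
  (forall m a, is_infimum (range (shift m u)) a -> D a) ->
  is_liminf u w -> D w.
Proof.
move=> Dc uD [z zu zw].
apply: (@closure_min _ (range z)) => //.
  by move=> _ [m _ <-]; exact: uD (zu m).
apply: supremum_closure => //; last exact: chain_tail_infima zu.
by exists (z 0%N); exact: imageT.
Qed.

End CompleteSemilattice.

(** * Closed cones in a Hausdorff semitopological semilattice *)

Lemma equalizer_closed {T U : topologicalType} {f g : T -> U} :
  hausdorff_space U -> continuous f -> continuous g ->
  closed [set x | f x = g x].
Proof.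
move=> hU fc gc p clp; apply: hU => A B /fc Af /gc Bg.
have fgp : nbhs p (f @^-1` A `&` g @^-1` B) by exact: filterI.
have [x [/= fg [fxA gxB]]] := clp _ fgp.
by exists (f x); split=> //; rewrite fg.
Qed.

Section HausdorffSemitopological.
Variable Y : topologizedSemilatticeType.
Hypothesis (Yh : hausdorff_space Y) (Ys : semitopological Y).

Lemma lower_cone_closed (a : Y) : closed [set y | sl_le y a].
Proof.
rewrite (_ : mkset _ = [set y | (y * a)%g = y]); last first.
  by apply/seteqP; split=> y /sl_leP.
by apply: equalizer_closed => //; [exact: Ys.2|move=> y].
Qed.

Lemma upper_cone_closed (a : Y) : closed [set y | sl_le a y].
Proof.
rewrite (_ : mkset _ = [set y | (a * y)%g = a]); last first.
  by apply/seteqP; split=> y /sl_leP.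
by apply: equalizer_closed => //; [exact: Ys.1|move=> y; exact: cvg_cst].
Qed.

End HausdorffSemitopological.

(** * Chains without countable cofinal parts *)

Section StrictlyDirectedChain.
Variables (T : Type) (le lt : T -> T -> Prop).
Hypotheses (lt_le : forall s t, lt s t -> le s t)
  (le_refl : forall t, le t t)
  (le_lt_trans : forall s t r, le s t -> lt t r -> lt s r)
  (lt_above : forall t, exists r, lt t r)
  (countable_bound : forall u : nat -> T,
    (forall i j, le (u i) (u j) \/ le (u j) (u i)) ->
    exists r, forall i, le (u i) r).

(** An ordinal-free form of a strictly increasing sequence of length omega_1.
    Let K be a maximal chain for [lt].  If no element of K were strictly above
    all [u n], then u would be cofinal in K; an element r strictly above a
    bound of u would be comparable with all of K, hence in K by maximality, and
    r is strictly above all [u n] after all. *)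
Lemma strictly_directed_chain (t0 : T) : exists K : set T,
  [/\ K !=set0, total_on K le &
      forall u : nat -> T, (forall n, K (u n)) ->
        exists2 r, K r & forall n, lt (u n) r].
Proof.
pose cmp s t := s = t \/ lt s t.
have [K [Kc Kmax]] : exists K : set T, total_on K cmp /\
    forall B, K `<` B -> ~ total_on B cmp.
  apply: Zorn_bigcup => F Fc Ftot s t [A FA As] [B FB Bt].
  by have [AB|BA] := Ftot _ _ FA FB; [apply: (Fc B)|apply: (Fc A)] => //;
    [exact: AB|exact: BA].
have Kadd r : (forall t, K t -> cmp t r) -> K r.
  move=> Kr; apply: contrapT => nKr; apply: (Kmax (K `|` [set r])).
    split; first by left.
    by move=> /(_ r) KrK; apply: nKr; apply: KrK; right.
  move=> s t [Ks|->] [Kt|->]; first exact: Kc.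
  - by left; exact: Kr.
  - by right; exact: Kr.
  - by left; left.
have cmp_le s t : cmp s t -> le s t by case=> [->|/lt_le].
have Ktot : total_on K le.
  by move=> s t Ks Kt; case: (Kc _ _ Ks Kt) => /cmp_le; [left|right].
exists K; split=> //.
  apply: contrapT => K0; apply: (K0); exists t0; apply: Kadd => t Kt.
  by case: K0; exists t.
move=> u uK; apply: contrapT => nr.
have Ku t : K t -> exists n, le t (u n).
  move=> Kt; apply: contrapT => nt; apply: nr; exists t => // n.
  have [tu|[ut|//]] := Kc _ _ Kt (uK n).
    by case: nt; exists n; exact: cmp_le.
  by case: nt; exists n; rewrite ut.
have [b ub] := countable_bound (fun i j => Ktot _ _ (uK i) (uK j)).
have [r br] := lt_above b.
have ur n : lt (u n) r by exact: le_lt_trans (ub n) br.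
apply: nr; exists r => //; apply: Kadd => t /Ku [n tu].
by right; exact: le_lt_trans tu (ur n).
Qed.

End StrictlyDirectedChain.

(** * Limits of image sequences *)

Section ContinuousHomomorphism.
Variables (X Y : topologizedSemilatticeType) (h : {multiplicative X -> Y}).
Hypotheses (Xc : complete_semilattice X) (Yh : hausdorff_space Y)
  (Ys : semitopological Y) (hc : continuous h).

Lemma preimage_closed_hom (D : set Y) : closed D -> closed (h @^-1` D).
Proof. by move=> Dc; apply: preimage_closed => // x _; exact: hc. Qed.

(** [h a] is below all but finitely many [h (u n)], and its upper cone is
    closed. *)
Lemma infimum_tail_le (u : nat -> X) (y : Y) m a :
  h \o u @ \oo --> y -> is_infimum (range (shift m u)) a -> sl_le (h a) y.
Proof.
move=> uy [au _].
apply: (closed_cvg [set y | sl_le (h a) y]) uy; first exact: upper_cone_closed.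
exists m => // n /= mn; apply: homo_sl_le; apply: au.
by exists (n - m)%N => //; rewrite /shift subnKC.
Qed.

(** The terms of v are chosen one by one.  Before step k, the list [Ls k] holds
    y and the products with y of the images of the finitely many blocks of
    consecutive terms that end at the last term chosen; all its elements l are
    in U and below y.  Since [l * h (u n)] tends to [l * y = l], all large n
    keep every [l * h (u n)] in U.  The factor y is what lets separate
    continuity suffice. *)
Lemma finer_products_in (u : nat -> X) (y : Y) (U : set Y) :
  h \o u @ \oo --> y -> open U -> U y ->
  exists2 v, finer v u &
    forall m n, U (h (prefix_prod (shift m v) n) * y)%g.
Proof.
move=> uy Uo Uy.
pose good (L : seq Y) := {in L, forall l, U l /\ sl_le l y}.
(* The index n found is at least k, which makes v finer than u. *)
have step (kL : nat * seq Y) : exists n, good kL.2 ->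
    (kL.1 <= n)%N /\ {in kL.2, forall l, U (l * h (u n))%g}.
  case: kL => k L /=; have [Lg|nLg] := pselect (good L); last by exists 0%N.
  suff [n [kn nL]] : exists n, (k <= n)%N /\ {in L, forall l, U (l * h (u n))%g}.
    by exists n.
  have ev : \forall n \near \oo, {in L, forall l, U (l * h (u n))%g}.
    elim: L Lg => [|l L IH] Lg; first by exists 0%N.
    have /IH {}IH : good L by move=> x xL; apply: Lg; rewrite inE xL orbT.
    have [Ul /sl_leP ly] := Lg l (mem_head _ _).
    have lU : \forall n \near \oo, U (l * h (u n))%g.
      apply: (uy [set b | U (l * b)%g]).
      apply: (Ys.1 l y); rewrite ly; exact: open_nbhs_nbhs.
    near=> n => x; rewrite inE => /orP[/eqP ->|]; first by near: n.
    by move: x; near: n.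
  have [N _ NP] := ev; exists (maxn k N); split; first exact: leq_maxl.
  by apply: NP; exact: leq_maxr.
have [f fP] := choice step.
pose Ls := fix Ls k := if k is k'.+1 then
  y :: [seq (l * h (u (f (k', Ls k'))))%g | l <- Ls k'] else [:: y].
have Lg k : good (Ls k).
  elim: k => [|k IH] l /=.
    by rewrite inE => /eqP ->; split=> //; exact: sl_le_refl.
  rewrite inE => /orP[/eqP ->|/mapP [x xL ->]].
    by split=> //; exact: sl_le_refl.
  split; first exact: (fP (k, Ls k) IH).2.
  exact: sl_le_trans (sl_mul_lel _ _) (IH x xL).2.
have yL k : y \in Ls k by case: k => [|k] /=; exact: mem_head.
pose v k := u (f (k, Ls k)); exists v.
  apply/finer_tailP => m; exists m => // n /= mn.
  exists (f (n, Ls n)) => //=.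
  exact: leq_trans mn (fP (n, Ls n) (Lg n)).1.
move=> m n.
suff mem : (h (prefix_prod (shift m v) n) * y)%g \in Ls (m + n).+1.
  exact: (Lg _ _ mem).1.
elim: n => [|n IH]; rewrite /= ?addn0 inE; apply/orP; right; apply/mapP.
  by exists y => //; rewrite slmulC /shift addn0.
exists (h (prefix_prod (shift m v) n) * y)%g; first by rewrite addnS.
by rewrite gmulfM -!mulgA (slmulC y).
Unshelve. all: by end_near.
Qed.

(** Separate e from y by disjoint open sets A and B, and let v have its partial
    products, multiplied by y, in B.  The infimum a of a tail of v is in the
    closure of the partial products of that tail, and [h a = h a * y] because [h a] is below y; hence
    [h a] lies in the closed complement of A, and so does the image of the
    limit inferior.  Controlling all tails of v at once is needed here: the
    limit inferior depends on all of them. *)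
Lemma finer_liminf_neq (u : nat -> X) (y e : Y) :
  h \o u @ \oo --> y -> e <> y ->
  exists2 v, finer v u & forall w, is_liminf v w -> h w <> e.
Proof.
move=> uy ey; have := Yh; rewrite open_hausdorff => /(_ e y).
case=> [|[A B] /= [/set_mem eA /set_mem yB] [Ao Bo /eqP AB]]; first exact/eqP.
have [v vu vB] := finer_products_in uy Bo yB.
have vy : h \o v @ \oo --> y by exact: finer_cvg uy.
exists v => // w vw hwe.
have BA : B `<=` ~` A by move=> b Bb Ab; rewrite -[False]/(set0 b) -AB.
have Ac : closed (~` A) by exact: open_closedC.
suff : (~` A) (h w) by rewrite hwe; exact.
apply: (liminf_closed Xc (D := h @^-1` (~` A))) vw; first exact: preimage_closed_hom.
move=> m a va /=; have /sl_leP <- := infimum_tail_le vy va.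
have muly : continuous (fun x => (h x * y)%g).
  move=> x.
  exact: (@continuous_comp _ _ _ h (fun z => z * y)%g x (@hc x) (Ys.2 y (h x))).
rewrite -[_ _]/(((fun x => (h x * y)%g) @^-1` (~` A)) a).
apply: (@closure_min _ (range (prefix_prod (shift m v)))).
- by move=> _ [n _ <-]; exact: BA (vB m n).
- by apply: preimage_closed => // x _; exact: muly.
- exact: sequence_infimum_closure.
Qed.

(** Countable directedness gives all terms of a convergent sequence a single
    bound, whose lower cone is closed. *)
Lemma lower_set_sequentially_closed (K : set Y) :
  (forall k : nat -> Y, (forall n, K (k n)) ->
    exists2 b, K b & forall n, sl_le (k n) b) ->
  sequentially_closed [set b | exists2 k, K k & sl_le b k].
Proof.
move=> Kd u l uK ul.
have [k kP] := choice (fun n => (exists2P _ _).1 (uK n)).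
have [b Kb kb] := Kd k (fun n => (kP n).1); exists b => //.
apply: (closed_cvg [set c | sl_le c b]) ul; first exact: lower_cone_closed.
by apply: nearW => n; exact: sl_le_trans (kP n).2 (kb n).
Qed.

Hypothesis Yseq : sequential_space Y.

Lemma limit_in_range (u : nat -> X) (y : Y) :
  h \o u @ \oo --> y -> range h y.
Proof.
move=> uy; apply: contrapT => ny.
have [w wP] := choice (liminf_exists Xc).
pose T := {v : nat -> X | h \o v @ \oo --> y}.
pose g (t : T) := w (sval t).
pose le (s t : T) := finer (sval t) (sval s).
pose lt s t := le s t /\ h (g s) <> h (g t).
have gle s t : le s t -> sl_le (g s) (g t).
  by move=> st; exact: finer_le_liminf st (wP _) (wP _).
have [K [[t0 Kt0] Ktot Kdir]] : exists K : set T,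
    [/\ K !=set0, total_on K le &
        forall k : nat -> T, (forall n, K (k n)) ->
          exists2 r, K r & forall n, lt (k n) r].
  have t0 : T by exists u.
  have lt_above t : exists r, lt t r.
    case: t => v vy; have hvy : h (w v) <> y by move=> hvy; apply: ny; exists (w v).
    have [r rv rneq] := finer_liminf_neq vy hvy.
    have ry : h \o r @ \oo --> y by exact: finer_cvg vy.
    by exists (exist _ r ry); split=> //= /esym; exact: rneq.
  have le_lt_trans s t r : le s t -> lt t r -> lt s r.
    move=> st [tr gtr]; split; first exact: finer_trans tr st.
    move=> gsr; apply: gtr; apply: sl_le_anti.
      by apply: homo_sl_le; exact: gle.
    by rewrite -gsr; apply: homo_sl_le; exact: gle.
  apply: (@strictly_directed_chain T le lt _ _ le_lt_trans lt_above _ t0) => //.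
  - by move=> s t [].
  - by move=> t S.
  - move=> k kK.
    have [v vk] := @finer_countable_bound _ (fun i => sval (k i))
      (fun i j => (or_comm _ _).1 (kK i j)).
    have vy : h \o v @ \oo --> y by apply: finer_cvg (svalP (k 0%N)); exact: vk.
    by exists (exist _ v vy).
have [s sK Ws] : exists2 s, (forall x, (g @` K) x -> sl_le x s) &
    closure (g @` K) s.
  have [|_ [s [sK _] Ws]] := Xc (ex_intro _ _ (imageP g Kt0)); last by exists s.
  move=> _ _ [a Ka <-] [b Kb <-].
  by case: (Ktot _ _ Ka Kb) => /gle; [left|right].
pose D := [set b | exists2 k, ((h \o g) @` K) k & sl_le b k].
have Dc : closed D.
  apply: Yseq; apply: lower_set_sequentially_closed => k kK.
  have [c cP] := choice (fun n => (exists2P _ _).1 (kK n)).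
  have [r Kr rP] := Kdir c (fun n => (cP n).1).
  exists (h (g r)); first by exists r.
  by move=> n; rewrite -(cP n).2; apply: homo_sl_le; exact: gle (rP n).1.
have gKD : g @` K `<=` h @^-1` D.
  move=> _ [t Kt <-]; exists (h (g t)); first by exists t.
  exact: sl_le_refl.
have [_ [t Kt <-] st] := closure_min gKD (preimage_closed_hom Dc) Ws.
(* A strict bound r of the constant sequence t: all of [h (g r)], [h s] and
   [h (g t)] coincide, although [lt t r]. *)
have [r Kr /(_ 0%N) [tr]] := Kdir (fun=> t) (fun=> Kt).
apply; apply: sl_le_anti; first by apply: homo_sl_le; exact: gle.
by apply: sl_le_trans st; apply: homo_sl_le; apply: sK; exists r.
Qed.

End ContinuousHomomorphism.

Unset Implicit Arguments.
Set Strict Implicit.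

Theorem theorem3 (X Y : topologizedSemilatticeType) (h : {multiplicative X -> Y}) :
  complete_semilattice X ->
  sequential_space Y -> hausdorff_space Y -> semitopological Y ->
  continuous h ->
  closed (range h).
Proof.
move=> Xc Yseq Yh Ys hc; apply: (Yseq) => v y vX vy.
have [u uP] := choice (fun n => (exists2P _ _).1 (vX n)).
have vE : v = h \o u by apply/funext => n /=; rewrite (uP n).2.
have uy : h \o u @ \oo --> y by rewrite -vE.
exact: (limit_in_range Xc Yh Ys hc Yseq uy).
Qed.
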